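(* Let $\mathcal T(d)$ be the set of unital quantum channels on $\mathcal B(\mathbb C^d)$ (channels $\mathcal E$ with $\mathcal E(I_d)=I_d$), and let $\mathrm{Ad}_{\mathrm{SU}(d)}=\{X\mapsto UXU^\dagger:U\in\mathrm{SU}(d)\}$. Then $$\nu_1(\mathcal T(d))=\nu_1(\mathrm{Ad}_{\mathrm{SU}(d)}).$$
   Context: For a quantum channel (completely positive trace-preserving map) $\mathcal E$ on $\mathcal B(\mathbb C^d)$, the Choi operator is $J_{\mathcal E}=\sum_{i,j}|i\rangle\langle j|\otimes\mathcal E(|i\rangle\langle j|)$ and the program state is $\pi_{\mathcal E}=J_{\mathcal E}/d$ on $\mathbb C^d\otimes\mathbb C^d$. HPTP means linear, Hermiticity preserving and trace preserving. The diamond norm is $\|\mathcal P\|_\diamond=\sup_R\sup_{\|X\|_1\le1}\|(\mathrm{id}_R\otimes\mathcal P)(X)\|_1$ over finite-dimensional references $R$. For a nonempty set $\mathcal S$ of channels on $\mathcal B(\mathbb C^d)$, the exact one-copy programming overhead is $\nu_1(\mathcal S)=\min\|\mathcal P\|_\diamond$ over all HPTP maps $\mathcal P:\mathcal B(\mathbb C^d\otimes(\mathbb C^d\otimes\mathbb C^d))\to\mathcal B(\mathbb C^d)$ (independent of the target) such that $\mathcal P(\rho\otimes\pi_{\mathcal E})=\mathcal E(\rho)$ for all states $\rho$ on $\mathbb C^d$ and all $\mathcal E\in\mathcal S$. *)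

(* Defs.v *)
From HB Require Import structures.
From mathcomp Require Import all_boot all_order all_algebra.
From mathcomp Require Import complex mxtens.
From mathcomp Require Import classical_sets reals constructive_ereal ereal.

Set Implicit Arguments.
Unset Strict Implicit.
Unset Printing Implicit Defensive.

Import Order.TTheory GRing.Theory Num.Theory.
Local Open Scope ring_scope.
Local Open Scope classical_set_scope.

(* B(C^n) is 'M[R[i]]_n and C^m (x) C^n is C^(m * n), with the index pairing
   mxtens_index of the Kronecker product A *t B. *)

Definition adjmx (R : realType) (m n : nat) (A : 'M[R[i]]_(m, n)) :
  'M[R[i]]_(n, m) := map_mx Num.conj A^T.

(* On R[i], 0 <= z means that z is real and nonnegative, so this includes
   Hermiticity. *)
Definition psdmx (R : realType) (n : nat) (A : 'M[R[i]]_n) : Prop :=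
  forall v : 'cV[R[i]]_n, 0 <= (adjmx v *m A *m v) 0 0.

Definition is_state (R : realType) (n : nat) (rho : 'M[R[i]]_n) : Prop :=
  psdmx rho /\ \tr rho = 1.

(* The sum of the singular values of A: the eigenvalues of the Hermitian
   matrix A^dagger A, with multiplicity, are the entries of spectral_diag. *)
Definition trace_norm (R : realType) (n : nat) (A : 'M[R[i]]_n) : R :=
  complex.Re (\sum_(i < n) sqrtC (spectral_diag (adjmx A *m A) 0 i)).

(* The block <i| X |j> of X, where i and j index the first tensor factor. *)
Definition ref_block (R : realType) (k m : nat) (X : 'M[R[i]]_(k * m))
    (i j : 'I_k) : 'M[R[i]]_m :=
  \matrix_(a, b) X (mxtens_index (i, a)) (mxtens_index (j, b)).

(* (id_k (x) P)(X); this is the tensor product of maps when P is linear. *)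
Definition id_tens (R : realType) (k m n : nat)
    (P : 'M[R[i]]_m -> 'M[R[i]]_n) (X : 'M[R[i]]_(k * m)) :
    'M[R[i]]_(k * n) :=
  \sum_(i < k) \sum_(j < k) delta_mx i j *t P (ref_block X i j).

Definition trace_preserving (R : realType) (m n : nat)
    (P : 'M[R[i]]_m -> 'M[R[i]]_n) : Prop :=
  forall X, \tr (P X) = \tr X.

Definition hermiticity_preserving (R : realType) (m n : nat)
    (P : 'M[R[i]]_m -> 'M[R[i]]_n) : Prop :=
  forall X, adjmx X = X -> adjmx (P X) = P X.

Definition completely_positive (R : realType) (m n : nat)
    (P : 'M[R[i]]_m -> 'M[R[i]]_n) : Prop :=
  forall (k : nat) (X : 'M[R[i]]_(k * m)), psdmx X -> psdmx (id_tens P X).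

Definition is_channel (R : realType) (d : nat)
    (E : 'M[R[i]]_d -> 'M[R[i]]_d) : Prop :=
  [/\ linear E, completely_positive E & trace_preserving E].

Definition is_hptp (R : realType) (m n : nat)
    (P : 'M[R[i]]_m -> 'M[R[i]]_n) : Prop :=
  [/\ linear P, hermiticity_preserving P & trace_preserving P].

Definition diamond_norm (R : realType) (m n : nat)
    (P : 'M[R[i]]_m -> 'M[R[i]]_n) : \bar R :=
  ereal_sup [set y : \bar R | exists (k : nat) (X : 'M[R[i]]_(k * m)),
    trace_norm X <= 1 /\ y = (trace_norm (id_tens P X))%:E].

Definition choi (R : realType) (d : nat) (E : 'M[R[i]]_d -> 'M[R[i]]_d) :
    'M[R[i]]_(d * d) :=
  \sum_(i < d) \sum_(j < d) delta_mx i j *t E (delta_mx i j).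

Definition program_state (R : realType) (d : nat)
    (E : 'M[R[i]]_d -> 'M[R[i]]_d) : 'M[R[i]]_(d * d) :=
  (d%:R : R[i])^-1 *: choi E.

Definition programs (R : realType) (d : nat)
    (S : set ('M[R[i]]_d -> 'M[R[i]]_d))
    (P : 'M[R[i]]_(d * (d * d)) -> 'M[R[i]]_d) : Prop :=
  is_hptp P /\
  forall (rho : 'M[R[i]]_d) (E : 'M[R[i]]_d -> 'M[R[i]]_d),
    is_state rho -> S E -> P (rho *t program_state E) = E rho.

(* nu_1(S) = v: the diamond norms of the maps programming S have a minimum,
   it is attained, and it equals the real number v. *)
Definition is_overhead (R : realType) (d : nat)
    (S : set ('M[R[i]]_d -> 'M[R[i]]_d)) (v : R) : Prop :=
  (exists2 P, programs S P & diamond_norm P = v%:E) /\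
  (forall P, programs S P -> (v%:E <= diamond_norm P)%E).

Definition unital_channels (R : realType) (d : nat) :
    set ('M[R[i]]_d -> 'M[R[i]]_d) :=
  [set E | is_channel E /\ E 1%:M = 1%:M].

Definition SU (R : realType) (d : nat) : set 'M[R[i]]_d :=
  [set U | U \is unitarymx /\ \det U = 1].

Definition Ad (R : realType) (d : nat) (U X : 'M[R[i]]_d) : 'M[R[i]]_d :=
  U *m X *m adjmx U.

Definition Ad_SU (R : realType) (d : nat) :
    set ('M[R[i]]_d -> 'M[R[i]]_d) :=
  [set Ad U | U in @SU R d].

(* Main.v *)
Require Import Defs.
From mathcomp Require Import all_boot all_order all_algebra.
From mathcomp Require Import complex mxtens ring.
From mathcomp Require Import boolp classical_sets reals constructive_ereal ereal.
From mathcomp Require Import topology normedtype.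

(* The unital trace-preserving linear maps lie in the linear span of the maps
   [Ad U], [U] unitary, and the programming equation [P (rho (x) pi_E) = E rho]
   is linear in [E]; so a map programs [Ad_SU] iff it programs all unital
   channels, and the two minimization problems have the same feasible set.

   For the span: it is closed under composition, and contains [X |-> P X (1 - P)]
   for every orthogonal projection [P]. Diagonal projections isolate single
   off-diagonal entries, the projection onto the uniform vector mixes them with
   the diagonal, and together they produce all rank-one maps between traceless
   matrices; a unital channel is the identity plus a sum of those.

   For existence: the trace norm of [A] is the maximum of [Re tr (B A)] over
   contractions [B], so each sublevel set of the diamond norm on the feasible set
   is cut out by closed conditions; it is bounded, since the diamond norm bounds
   the coefficients of a map, and nested compact sets have a common point. *)

Set Implicit Arguments.
Unset Strict Implicit.
Unset Printing Implicit Defensive.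

Import Order.TTheory GRing.Theory Num.Theory numFieldNormedType.Exports.
Local Open Scope ring_scope.

(** * The trace norm as a maximum over contractions *)

Section TraceNorm.
Context {R : realType}.
Local Notation C := R[i].

Lemma adjmxM m n p (A : 'M[C]_(m, n)) (B : 'M[C]_(n, p)) :
  adjmx (A *m B) = adjmx B *m adjmx A.
Proof. by rewrite /adjmx trmx_mul map_mxM. Qed.

Lemma adjmxK m n (A : 'M[C]_(m, n)) : adjmx (adjmx A) = A.
Proof. exact: trmxCK. Qed.

Lemma adjmxD m n (A B : 'M[C]_(m, n)) : adjmx (A + B) = adjmx A + adjmx B.
Proof. by rewrite /adjmx linearD /= map_mxD. Qed.

Lemma adjmxN m n (A : 'M[C]_(m, n)) : adjmx (- A) = - adjmx A.
Proof. by rewrite /adjmx linearN /= map_mxN. Qed.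

Lemma adjmxZ m n a (A : 'M[C]_(m, n)) : adjmx (a *: A) = a^* *: adjmx A.
Proof. by rewrite /adjmx linearZ /= map_mxZ. Qed.

Lemma adjmx1 n : adjmx (1%:M : 'M[C]_n) = 1%:M.
Proof. by rewrite /adjmx trmx1 map_mx1. Qed.

Lemma adjmx_delta m n i j :
  adjmx (delta_mx i j : 'M[C]_(m, n)) = delta_mx j i.
Proof. by rewrite /adjmx trmx_delta map_delta_mx. Qed.

Lemma adjmx_tens m n p q (A : 'M[C]_(m, n)) (B : 'M[C]_(p, q)) :
  adjmx (A *t B) = adjmx A *t adjmx B.
Proof. by rewrite /adjmx trmx_tens map_mxT. Qed.

Lemma dotmx_adj n (u v : 'rV[C]_n) : dotmx u v = (u *m adjmx v) 0 0.
Proof. exact: dotmxE. Qed.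

Lemma mulmx_delta m n p q (i : 'I_m) (j : 'I_n) (Y : 'M[C]_(n, p))
    (k : 'I_p) (l : 'I_q) :
  delta_mx i j *m Y *m delta_mx k l = Y j k *: delta_mx i l.
Proof.
apply/matrixP => a b; rewrite !mxE (bigD1 k) //= big1 ?addr0; last first.
  by move=> c ck; rewrite !mxE (negbTE ck) mulr0.
rewrite !mxE (bigD1 j) //= big1 ?addr0; last first.
  by move=> c cj; rewrite !mxE (negbTE cj) andbF mul0r.
by rewrite !mxE !eqxx andbT mulrAC mulrC -natrM mulnb.
Qed.

(* Norms are taken on row vectors, so this says that the adjoint of [B] (hence
   [B] itself) has operator norm at most 1. *)
Definition contraction m n (B : 'M[C]_(m, n)) :=
  forall v : 'rV[C]_m, dotmx (v *m B) (v *m B) <= dotmx v v.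

Lemma contractionM m n p (A : 'M[C]_(m, n)) (B : 'M[C]_(n, p)) :
  contraction A -> contraction B -> contraction (A *m B).
Proof.
by move=> cA cB v; rewrite mulmxA; apply: le_trans (cB _) (cA _).
Qed.

Lemma contractionZ m n (z : C) (B : 'M[C]_(m, n)) :
  `|z| <= 1 -> contraction B -> contraction (z *: B).
Proof.
move=> z1 cB v; rewrite -scalemxAr linearZl_LR linearZr_LR /= mulrA -normCK.
apply: le_trans (cB v); apply: ler_piMl; first exact: dnorm_ge0.
by rewrite expr_le1.
Qed.

Lemma contraction0 m n : contraction (0 : 'M[C]_(m, n)).
Proof. by move=> v; rewrite mulmx0 linear0l dnorm_ge0. Qed.

(** [Q] is Hermitian by construction, so idempotence makes it an orthogonal projection, and |v|^2 -
    |v B|^2 is the squared norm of [v *m (1%:M - Q)]. *)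
Lemma contraction_proj m n (B : 'M[C]_(m, n)) (Q := B *m adjmx B) :
  Q *m Q = Q -> contraction B.
Proof.
move=> QQ v; have Qh : adjmx Q = Q by rewrite adjmxM adjmxK.
have : 0 <= dotmx (v *m (1%:M - Q)) (v *m (1%:M - Q)) by exact: dnorm_ge0.
rewrite !dotmx_adj !(adjmxM v) adjmxD adjmxN adjmx1 Qh.
rewrite -[_ <= _ in X in _ -> X]subr_ge0; congr (is_true (0 <= _)).
rewrite mulmxA -(mulmxA v) mulmxBr mulmx1 mulmxBl mul1mx QQ subrr subr0.
by rewrite mulmxBr mulmxBl mulmx1 mxE [X in _ + X]mxE !mulmxA.
Qed.

Lemma gram_spectral m n (A : 'M[C]_(m, n)) (U := spectralmx (adjmx A *m A)) :
  [/\ U *m adjmx U = 1%:M, adjmx U *m U = 1%:M &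
  adjmx A *m A = adjmx U *m diag_mx (spectral_diag (adjmx A *m A)) *m U].
Proof.
have Uu : U \is unitarymx := spectral_unitarymx _.
have UU : U *m adjmx U = 1%:M by apply/unitarymxP.
split=> //; first exact: mulmx1C.
suff /orthomx_spectralP gA : adjmx A *m A \is normalmx.
  by rewrite {1}gA invmx_unitary.
by apply/normalmxP; rewrite -[X in _ *m X = X *m _]/(adjmx _) adjmxM adjmxK.
Qed.

(** Since [U] diagonalizes A^dagger A, the rows of U A^dagger are orthogonal and their lengths are
    the singular values of [A]. *)
Lemma gram_diagE m n (A : 'M[C]_(m, n)) (U := spectralmx (adjmx A *m A)) i :
  spectral_diag (adjmx A *m A) 0 i =
  dotmx (row i (U *m adjmx A)) (row i (U *m adjmx A)).
Proof.
have [UU _] := gram_spectral A; rewrite -/U; set d := spectral_diag _ => gA.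
have : U *m adjmx A *m adjmx (U *m adjmx A) = diag_mx d.
  rewrite adjmxM adjmxK !mulmxA -(mulmxA U) gA.
  by rewrite !mulmxA UU mul1mx -mulmxA UU mulmx1.
move/matrixP/(_ i i); rewrite [RHS]mxE eqxx mulr1n => <-.
by rewrite dotmx_adj !mxE; apply: eq_bigr => k _; rewrite !mxE.
Qed.

Lemma gram_diag_ge0 m n (A : 'M[C]_(m, n)) i :
  0 <= spectral_diag (adjmx A *m A) 0 i.
Proof. by rewrite gram_diagE dnorm_ge0. Qed.

Lemma trace_normC n (A : 'M[C]_n) :
  ((trace_norm A)%:C)%C =
  \sum_(i < n) sqrtC (spectral_diag (adjmx A *m A) 0 i).
Proof.
rewrite RRe_real // ger0_real // sumr_ge0 // => i _.
by rewrite sqrtC_ge0 gram_diag_ge0.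
Qed.

(** In the eigenbasis of A^dagger A the trace is a sum of inner products of rows of U B with rows of
    U A^dagger. Cauchy-Schwarz bounds each one: the former have length at most 1, the latter have
    the singular values as lengths. *)
Lemma trace_norm_ge n (A B : 'M[C]_n) :
  contraction B -> `|\tr (B *m A)| <= ((trace_norm A)%:C)%C.
Proof.
move=> cB; pose U := spectralmx (adjmx A *m A).
have [UU UU' _] := gram_spectral A; rewrite -/U in UU UU'.
have -> : \tr (B *m A) = \tr (U *m B *m adjmx (U *m adjmx A)).
  by rewrite adjmxM adjmxK mulmxA [RHS]mxtrace_mulC !mulmxA UU' mul1mx.
rewrite trace_normC; apply: le_trans (ler_norm_sum _ _ _) _.
apply: ler_sum => i _; rewrite gram_diagE -/U.
have -> : (U *m B *m adjmx (U *m adjmx A)) i i =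
    dotmx (row i (U *m B)) (row i (U *m adjmx A)).
  by rewrite dotmx_adj !mxE; apply: eq_bigr => k _; rewrite !mxE.
rewrite (le_trans (CauchySchwarz_sqrt _ _ _)) // ler_piMl ?sqrtC_ge0 ?dnorm_ge0 //.
rewrite -sqrtC1 ler_sqrtC ?nnegrE ?dnorm_ge0 ?ler01 // row_mul.
apply: le_trans (cB _) _; have /row_unitarymxP -> : U \is unitarymx by apply/unitarymxP.
by rewrite eqxx.
Qed.

(** The maximizer is |A|^+ A^dagger, with |A|^+ the pseudo-inverse of the square root of A^dagger A.
    It is a contraction because B B^dagger is the support projection of |A|, which is [Q] in the
    eigenbasis. *)
Lemma trace_norm_attained n (A : 'M[C]_n) :
  exists2 B, contraction B & \tr (B *m A) = ((trace_norm A)%:C)%C.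
Proof.
have := gram_spectral A; have := trace_normC A; have := @gram_diag_ge0 _ _ A.
move: (spectralmx _) (spectral_diag _) => U d d_ge0 trA [UU UU' gA].
(* The convention that the inverse of 0 is 0 makes [S] the pseudo-inverse of the singular values. *)
pose S : 'rV[C]_n := \row_i (sqrtC (d 0 i))^-1.
have Sh : adjmx (diag_mx S) = diag_mx S.
  rewrite /adjmx tr_diag_mx map_diag_mx; congr diag_mx; apply/rowP => i.
  rewrite !mxE; apply/CrealP; rewrite ger0_real // invr_ge0 sqrtC_ge0.
  exact: d_ge0.
have SE i : S 0 i = (sqrtC (d 0 i))^-1 by rewrite mxE.
clearbody S; pose Q := diag_mx S *m diag_mx d *m diag_mx S.
have QQ : Q *m Q = Q.
  rewrite /Q !mulmx_diag; congr diag_mx; apply/rowP => i; rewrite !mxE SE.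
  have [->|d0] := eqVneq (d 0 i) 0; first by rewrite !(mul0r, mulr0).
  have s0 : sqrtC (d 0 i) != 0 by rewrite sqrtC_eq0.
  have := sqrtCK (d 0 i); move: (sqrtC _) s0 => s s0 <-.
  by rewrite expr2; field.
exists (adjmx U *m diag_mx S *m U *m adjmx A).
  apply: contraction_proj; rewrite !adjmxM !adjmxK Sh.
  have : Q = diag_mx S *m diag_mx d *m diag_mx S by [].
  clearbody Q; move: UU gA; move: (adjmx U) (adjmx A) (diag_mx S) (diag_mx d).
  move=> V A' DS Dd UV A'A QE.
  have -> : V *m DS *m U *m A' *m (A *m (V *m (DS *m U))) = V *m Q *m U.
    rewrite QE !mulmxA -(mulmxA _ A') A'A !mulmxA.
    by rewrite -(mulmxA _ U) UV mulmx1 -(mulmxA _ U) UV mulmx1.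
  by rewrite -(mulmxA (V *m Q)) !(mulmxA U) UV mul1mx mulmxA -(mulmxA V) QQ.
rewrite trA -mulmxA gA !mulmxA -(mulmxA _ U) UU mulmx1.
rewrite mxtrace_mulC !mulmxA UU mul1mx mulmx_diag mxtrace_diag.
apply: eq_bigr => i _; rewrite !mxE SE -{2}[d 0 i]sqrtCK.
have [->|s0] := eqVneq (sqrtC (d 0 i)) 0; first by rewrite expr2 !mulr0.
by rewrite expr2 mulKf.
Qed.

Lemma Re_le_norm (z : C) c : `|z| <= (c%:C)%C -> complex.Re z <= c.
Proof.
move=> zc; rewrite -lecR; apply: le_trans zc; apply: le_trans (normc_ge_Re _).
by rewrite lecR ler_norm.
Qed.

Lemma trace_norm_leP n (A : 'M[C]_n) c :
  trace_norm A <= c <->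
  forall B, contraction B -> complex.Re (\tr (B *m A)) <= c.
Proof.
split=> [Ac B cB|Ac]; last first.
  by have [B cB trBA] := trace_norm_attained A; have := Ac B cB; rewrite trBA.
by apply: le_trans Ac; exact/Re_le_norm/trace_norm_ge.
Qed.

End TraceNorm.

(** * The linear span of the unitary channels *)

Section AdSpan.
Context {R : realType}.
Local Notation C := R[i].

Lemma Ad_linear d (U : 'M[C]_d) : linear (Ad U).
Proof.
by move=> a X Y; rewrite /Ad mulmxDr mulmxDl -scalemxAr -scalemxAl.
Qed.

Lemma linear_map0 (V W : lmodType C) (f : V -> W) : linear f -> f 0 = 0.
Proof. by move=> lf; have := lf (-1) 0 0; rewrite !scaleN1r oppr0 addr0 addNr. Qed.

Lemma linear_mapD (V W : lmodType C) (f : V -> W) :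
  linear f -> {morph f : u v / u + v}.
Proof. by move=> lf u v; have := lf 1 u v; rewrite !scale1r. Qed.

Lemma linear_mapZ (V W : lmodType C) (f : V -> W) a :
  linear f -> {morph f : u / a *: u}.
Proof. by move=> lf u; have := lf a u 0; rewrite (linear_map0 lf) !addr0. Qed.

Lemma linear_map_sum (V W : lmodType C) (f : V -> W) I r (P : pred I) F :
  linear f -> f (\sum_(i <- r | P i) F i) = \sum_(i <- r | P i) f (F i).
Proof. by move=> lf; apply: big_morph; [exact: linear_mapD | exact: linear_map0]. Qed.

(** Determinants are left free: a global phase cancels in [Ad], and [Ad_unitary_SU] restores
    determinant one afterwards. *)
Inductive Ad_span (d : nat) : ('M[C]_d -> 'M[C]_d) -> Prop :=
| Ad_span_unitary U : U \is unitarymx -> Ad_span (Ad U)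
| Ad_spanD E F : Ad_span E -> Ad_span F -> Ad_span (fun X => E X + F X)
| Ad_spanZ a E : Ad_span E -> Ad_span (fun X => a *: E X)
| Ad_span_ext E F : E =1 F -> Ad_span E -> Ad_span F.

Lemma unitarymx1 d : (1%:M : 'M[C]_d) \is unitarymx.
Proof. by apply/unitarymxP; rewrite trmx1 map_mx1 mulmx1. Qed.

Section Fixed.
Context {d : nat}.
Implicit Types (E F : 'M[C]_d -> 'M[C]_d) (X : 'M[C]_d).

Lemma Ad_span_id : Ad_span (@id 'M[C]_d).
Proof.
apply: Ad_span_ext (Ad_span_unitary (unitarymx1 d)) => X.
by rewrite /Ad adjmx1 mulmx1 mul1mx.
Qed.

Lemma Ad_span0 : Ad_span (fun _ : 'M[C]_d => 0).
Proof. by apply: Ad_span_ext (Ad_spanZ 0 Ad_span_id) => X; rewrite scale0r. Qed.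

(** Conjugations compose to the conjugation by the product of the unitaries; bilinearity of
    composition does the rest. *)
Lemma Ad_span_comp E F : Ad_span E -> Ad_span F -> Ad_span (fun X => E (F X)).
Proof.
move=> sE sF; elim: sE => {E} [U Uu|E E' _ sE _ sE'|a E _ sE|E E' EE' _ sE].
- elim: sF => {F} [V Vu|F F' _ sF _ sF'|a F _ sF|F F' FF' _ sF].
  + apply: (Ad_span_ext _ (Ad_span_unitary (mul_unitarymx Uu Vu))) => X.
    by rewrite /Ad adjmxM !mulmxA.
  + apply: Ad_span_ext (Ad_spanD sF sF') => X.
    by rewrite (linear_mapD (Ad_linear U)).
  + apply: Ad_span_ext (Ad_spanZ a sF) => X.
    by rewrite (linear_mapZ _ (Ad_linear U)).
  + by apply: Ad_span_ext sF => X; rewrite FF'.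
- exact: Ad_spanD sE sE'.
- exact: (Ad_spanZ a sE).
- by apply: Ad_span_ext sE => X; rewrite EE'.
Qed.

Lemma Ad_span_sum I (r : seq I) (P : pred I) (E : I -> 'M[C]_d -> 'M[C]_d) :
  (forall i, P i -> Ad_span (E i)) ->
  Ad_span (fun X => \sum_(i <- r | P i) E i X).
Proof.
move=> sE; elim: r => [|i r IHr].
  by apply: Ad_span_ext Ad_span0 => X; rewrite big_nil.
case Pi: (P i); last by apply: Ad_span_ext IHr => X; rewrite big_cons Pi.
by apply: Ad_span_ext (Ad_spanD (sE _ Pi) IHr) => X; rewrite big_cons Pi.
Qed.

Lemma Ad_spanB E F : Ad_span E -> Ad_span F -> Ad_span (fun X => E X - F X).
Proof.
move=> sE sF; apply: Ad_span_ext (Ad_spanD sE (Ad_spanZ (-1) sF)) => X.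
by rewrite scaleN1r.
Qed.

Lemma Ad_span_unscale a E : a != 0 -> Ad_span (fun X => a *: E X) -> Ad_span E.
Proof.
move=> a0 /(Ad_spanZ a^-1); apply: Ad_span_ext => X.
by rewrite scalerA mulVf // scale1r.
Qed.

(* Averaging [Ad (z P + Q)], [Q = 1 - P], against [z^*] over the four phases
   [z = 1, -1, i, -i] isolates the component [P X Q]. *)
Lemma Ad_span_proj (P : 'M[C]_d) :
  adjmx P = P -> P *m P = P -> Ad_span (fun X => P *m X *m (1%:M - P)).
Proof.
move=> Ph PP; set Q := 1%:M - P.
have Qh : adjmx Q = Q by rewrite /Q adjmxD adjmxN adjmx1 Ph.
have PQ : P *m Q = 0 by rewrite mulmxBr mulmx1 PP subrr.
have QP : Q *m P = 0 by rewrite mulmxBl mul1mx PP subrr.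
have QQ : Q *m Q = Q by rewrite {2}/Q mulmxBr mulmx1 QP subr0.
have PQ1 : P + Q = 1%:M by rewrite addrC subrK.
clearbody Q; pose U z := z *: P + Q.
have Uh z : adjmx (U z) = z^* *: P + Q by rewrite adjmxD adjmxZ Ph Qh.
have Uu z : z * z^* = 1 -> U z \is unitarymx.
  move=> z1; apply/unitarymxP; rewrite -[map_mx _ _]/(adjmx (U z)) Uh.
  rewrite mulmxDl !mulmxDr -!scalemxAl -!scalemxAr PP PQ QP QQ !scaler0.
  by rewrite scalerA z1 scale1r addr0 add0r PQ1.
have ii : 'i * 'i^* = 1 :> C by rewrite conjCi mulrN -expr2 sqrCi opprK.
have Uphase z : z * z^* = 1 -> Ad_span (Ad (U z)).
  by move=> z1; apply/Ad_span_unitary/Uu.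
have s1 : Ad_span (Ad (U 1)) by apply: Uphase; rewrite rmorph1 mulr1.
have s2 : Ad_span (Ad (U (-1))) by apply: Uphase; rewrite rmorphN rmorph1 mulrNN mulr1.
have s3 : Ad_span (Ad (U 'i)) by apply: Uphase.
have s4 : Ad_span (Ad (U (- 'i))) by apply: Uphase; rewrite rmorphN mulrNN.
have AdU z X : Ad (U z) X =
    (z * z^*) *: (P *m X *m P) + z *: (P *m X *m Q) +
    z^* *: (Q *m X *m P) + Q *m X *m Q.
  rewrite /Ad Uh mulmxDl !mulmxDr !mulmxDl -!scalemxAl -!scalemxAr scalerA.
  by rewrite addrACA addrA.
have cN1 : (-1)^* = -1 :> C by rewrite rmorphN rmorph1.
have cNi : (- 'i)^* = 'i :> C by rewrite rmorphN /= conjCi opprK.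
clearbody U; apply: (@Ad_span_unscale 4); first by rewrite pnatr_eq0.
apply: Ad_span_ext (Ad_spanB (Ad_spanB s1 s2) (Ad_spanZ 'i (Ad_spanB s3 s4))) => X.
rewrite !AdU cN1 conjC1 cNi conjCi.
move: (P *m X *m P) (P *m X *m Q) (Q *m X *m P) (Q *m X *m Q) => A B D F.
apply/matrixP => i j; rewrite !mxE.
have := sqrCi C; move: (A i j) (B i j) (D i j) (F i j) => {}A {}B {}D {}F.
move: 'i => w w2.
by ring: w2.
Qed.

End Fixed.
End AdSpan.

(** * Unital trace-preserving maps in the span of unitary conjugations *)

Section UnitalSpan.
Context {R : realType} {d : nat}.
Local Notation C := R[i].
Implicit Types (X : 'M[C]_d) (i j k l p q : 'I_d).

(** For d > 0 this is the orthogonal projection onto the uniform vector. By [mixerE], all rows of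
    [mixer X] are equal: they hold the column sums of [X] minus their mean, up to the factor 1/d. *)
Let J : 'M[C]_d := const_mx d%:R^-1.
Let mixer X := J *m X *m (1%:M - J).

Let mixerE X k l : mixer X k l =
  d%:R^-1 * (\sum_a X a l - d%:R^-1 * \sum_b \sum_a X a b).
Proof.
have JX b : (J *m X) k b = d%:R^-1 * \sum_a X a b.
  by rewrite mxE mulr_sumr; apply: eq_bigr => a _; rewrite mxE.
have JXJ : (J *m X *m J) k l = d%:R^-1 * (d%:R^-1 * \sum_b \sum_a X a b).
  rewrite mxE !mulr_sumr; apply: eq_bigr => b _.
  by rewrite JX mxE mulrC.
by rewrite /mixer mulmxBr mulmx1 mxE JX mulrBr -JXJ [X in _ + X]mxE.
Qed.

Let Ad_span_mixer : Ad_span mixer.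
Proof.
have [d0|d_gt0] := posnP d.
  apply: Ad_span_ext Ad_span0 => X; apply/matrixP => i.
  by have := ltn_ord i; rewrite {2}d0.
apply: Ad_span_proj; apply/matrixP => i j; rewrite !mxE.
  by rewrite fmorphV rmorph_nat.
rewrite (eq_bigr (fun _ => d%:R^-1 * d%:R^-1)); last by move=> a _; rewrite !mxE.
rewrite sumr_const card_ord -[LHS]mulr_natl mulrA mulfV ?mul1r //.
by rewrite pnatr_eq0 -lt0n.
Qed.

(** Cutting with the projection [D i] on the left and [D j] on the right isolates the entry; the
    complements that [Ad_span_proj] brings in disappear because [D i] and [D j] are orthogonal. *)
Lemma Ad_span_entry i j : i != j -> Ad_span (fun X => X i j *: delta_mx i j).
Proof.
move=> ij.
have [D DE] : exists D : 'I_d -> 'M[C]_d, forall k, D k = delta_mx k k.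
  by exists (fun k => delta_mx k k).
have Dh k : adjmx (D k) = D k by rewrite DE adjmx_delta.
have DD k : D k *m D k = D k by rewrite DE mul_delta_mx.
have Dij : D i *m D j = 0 by rewrite !DE mul_delta_mx_0.
have Dji : D j *m D i = 0 by rewrite !DE mul_delta_mx_0 // eq_sym.
have s1 := Ad_span_proj (Dh i) (DD i).
have s2 : Ad_span (fun X => (1%:M - D j) *m X *m D j).
  apply: (Ad_span_ext _ (@Ad_span_proj _ _ (1%:M - D j) _ _)) => [X||].
  - by rewrite opprB addrCA subrr addr0.
  - by rewrite adjmxD adjmxN adjmx1 Dh.
  - by rewrite mulmxBr mulmx1 mulmxBl mul1mx DD subrr subr0.
apply: Ad_span_ext (Ad_span_comp s2 s1) => X; rewrite -mulmx_delta -!DE.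
rewrite !mulmxA mulmxBl mul1mx Dji subr0.
by rewrite -mulmxA mulmxBl mul1mx Dij subr0.
Qed.

(** Isolate one entry, spread it over the matrix with [mixer], then isolate another entry. *)
Lemma Ad_span_move i j k l :
  i != j -> k != l -> Ad_span (fun X => X i j *: delta_mx k l).
Proof.
move=> ij kl; have d_gt1 : (1 < d)%N.
  have : (#|[set i; j]| <= #|{: 'I_d}|)%N by apply: max_card.
  by rewrite cards2 ij card_ord.
have d0 : d%:R != 0 :> C by rewrite pnatr_eq0 -lt0n ltnW.
(* This is the entry of [mixer (delta_mx i j)] at [k], [l]; it is nonzero because 1/d is neither 0
   nor 1 when d > 1. *)
pose c : C := d%:R^-1 * ((j == l)%:R - d%:R^-1).
apply: (@Ad_span_unscale _ _ c).
  rewrite mulf_neq0 ?invr_eq0 // subr_eq0 -(can_eq (mulfK d0)) mulVf // -natrM.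
  by rewrite pnatr_eq1; case: (j == l); rewrite ?mul0n // mul1n neq_ltn d_gt1 orbT.
have := Ad_span_comp (Ad_span_entry kl)
  (Ad_span_comp Ad_span_mixer (Ad_span_entry ij)).
apply: Ad_span_ext => X; rewrite scalerA mixerE; congr (_ *: _).
have E b : \sum_a (X i j *: delta_mx i j) a b = X i j * (j == b)%:R.
  rewrite (bigD1 i) //= big1 ?addr0 => [|a ai].
    by rewrite !mxE eqxx eq_sym.
  by rewrite !mxE (negbTE ai) mulr0.
rewrite E (eq_bigr (fun b => X i j * (j == b)%:R)) // -mulr_sumr.
rewrite (bigD1 j) //= eqxx big1 => [|b bj]; last by rewrite eq_sym (negbTE bj).
rewrite addr0 mulr1 /c; ring.
Qed.

Definition diag_part X := \sum_i X i i *: delta_mx i i : 'M[C]_d.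

(** It is the identity minus all the off-diagonal entry maps. *)
Lemma Ad_span_diag_part : Ad_span diag_part.
Proof.
have s := Ad_span_sum (index_enum _) (fun (p : 'I_d * 'I_d) pP =>
  @Ad_span_entry p.1 p.2 pP).
apply: Ad_span_ext (Ad_spanB Ad_span_id s) => X /=.
rewrite -(pair_big_dep xpredT (fun i j => i != j)
  (fun i j => X i j *: delta_mx i j)) /= [X in X - _]matrix_sum_delta -sumrB.
apply: eq_bigr => i _; rewrite (bigD1 i) //= (eq_bigl (fun j => i != j)) ?addrK //.
by move=> j; rewrite eq_sym.
Qed.

Definition traceless X : 'M[C]_d := X - (d%:R^-1 * \tr X)%:M.

Lemma traceless_linear : linear traceless.
Proof.
move=> a X Y; rewrite /traceless mxtraceD mxtraceZ mulrDr raddfD /= opprD addrACA.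
by rewrite mulrCA -(scale_scalar_mx _ a) scalerBr.
Qed.

(** Off the diagonal, [traceless] changes nothing and the entry is just moved. For a diagonal entry,
    the column sums of [diag_part X] are the [X b b], so [mixer] subtracts the mean tr X / d; the
    result is read in column [i] at an off-diagonal place [k], [i] and moved from there. *)
Lemma Ad_span_traceless_source i j p q :
  p != q -> Ad_span (fun X => traceless X i j *: delta_mx p q).
Proof.
move=> pq; have [<-{j}|ij] := eqVneq i j; last first.
  apply: Ad_span_ext (Ad_span_move ij pq) => X.
  by rewrite /traceless !mxE (negbTE ij) mulr0n subr0.
have [k ki] : exists k, k != i.
  by have [<-|] := eqVneq p i; [exists q; rewrite eq_sym | exists p].
have d0 : d%:R^-1 != 0 :> C by rewrite 
  invr_eq0 pnatr_eq0 -lt0n (leq_ltn_trans _ (ltn_ord i)).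
apply: (Ad_span_unscale d0).
have := Ad_span_comp (Ad_span_comp (Ad_span_move ki pq) Ad_span_mixer)
  Ad_span_diag_part.
apply: Ad_span_ext => X; rewrite scalerA mixerE; congr (_ *: _).
have E b : \sum_a diag_part X a b = X b b.
  rewrite (bigD1 b) //= big1 ?addr0 /diag_part => [|a ab].
    rewrite summxE (bigD1 b) //= big1 ?addr0 => [|c cb]; rewrite !mxE ?eqxx ?mulr1 //.
    by rewrite eq_sym (negbTE cb) mulr0.
  rewrite summxE big1 // => c _; rewrite !mxE.
  by case: eqP => [<-|]; rewrite ?mulr0 //= eq_sym (negbTE ab) mulr0.
by rewrite E (eq_bigr _ (fun b _ => E b)) /traceless !mxE eqxx mulr1n.
Qed.

(** This is the dual of the previous construction: the entry is moved to column [k] off the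
    diagonal, [mixer] copies its centred row into every row, and the diagonal part of that is a
    multiple of [traceless (delta_mx k k)]. *)
Lemma Ad_span_traceless_target p q k l :
  p != q -> Ad_span (fun X => X p q *: traceless (delta_mx k l)).
Proof.
move=> pq; have [<-{l}|kl] := eqVneq k l; last first.
  apply: Ad_span_ext (Ad_span_move pq kl) => X; congr (_ *: _).
  rewrite /traceless /mxtrace big1 ?mulr0 ?raddf0 ?addr0 // => a _.
  by rewrite mxE; case: eqP => // ->; rewrite (negbTE kl).
have [j jk] : exists j, j != k.
  by have [<-|] := eqVneq p k; [exists q; rewrite eq_sym | exists p].
have d0 : d%:R^-1 != 0 :> C by rewrite 
  invr_eq0 pnatr_eq0 -lt0n (leq_ltn_trans _ (ltn_ord k)).
apply: (Ad_span_unscale d0).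
have := Ad_span_comp Ad_span_diag_part
  (Ad_span_comp Ad_span_mixer (Ad_span_move pq jk)).
apply: Ad_span_ext => X; rewrite scalerA /diag_part.
have E b : \sum_a (X p q *: delta_mx j k) a b = X p q * (k == b)%:R.
  rewrite (bigD1 j) //= big1 ?addr0 => [|a aj].
    by rewrite !mxE eqxx eq_sym.
  by rewrite !mxE (negbTE aj) mulr0.
rewrite (eq_bigr (fun a => (d%:R^-1 * X p q) *:
    (((k == a)%:R - d%:R^-1) *: delta_mx a a))) => [|a _]; last first.
  rewrite mixerE scalerA; congr (_ *: _).
  rewrite E (eq_bigr _ (fun b _ => E b)) -mulr_sumr (bigD1 k) //= eqxx.
  rewrite big1 ?addr0 => [|b bk]; last by rewrite eq_sym (negbTE bk).
  by rewrite mulr1; ring.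
rewrite -scaler_sumr; congr (_ *: _); apply/matrixP => a b.
rewrite summxE /traceless !mxE.
have -> : \tr (delta_mx k k : 'M[C]_d) = 1.
  rewrite /mxtrace (bigD1 k) //= big1 ?addr0 => [|c ck]; first by rewrite mxE eqxx.
  by rewrite mxE (negbTE ck).
rewrite (bigD1 a) //= big1 ?addr0 => [|c ca]; last first.
  by rewrite !mxE (eq_sym a c) (negbTE ca) mulr0.
rewrite !mxE eqxx /= mulr1 (eq_sym b a) (eq_sym k a).
have [<-|ab] := eqVneq a b; first by rewrite andbb mulr1 mulr1n.
rewrite mulr0 mulr0n subr0.
by case: (eqVneq a k) ab => // ->; rewrite eq_sym => /negbTE ->.
Qed.

Lemma traceless_sum X :
  traceless X = \sum_i \sum_j X i j *: traceless (delta_mx i j).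
Proof.
rewrite {1}[X]matrix_sum_delta (linear_map_sum _ _ _ traceless_linear).
apply: eq_bigr => i _; rewrite (linear_map_sum _ _ _ traceless_linear).
by apply: eq_bigr => j _; rewrite (linear_mapZ _ traceless_linear).
Qed.

(** Source and target maps are joined through an arbitrary off-diagonal place [p], [q]. If there is
    none then d = 1 and traceless matrices vanish. *)
Lemma Ad_span_rank1 i j k l :
  Ad_span (fun X => traceless X i j *: traceless (delta_mx k l)).
Proof.
have [/existsP[[p q] /= pq]|] := boolP [exists u : 'I_d * 'I_d, u.1 != u.2].
  have := Ad_span_comp (Ad_span_traceless_target k l pq)
    (Ad_span_traceless_source i j pq).
  by apply: Ad_span_ext => X; rewrite !mxE !eqxx mulr1.
rewrite negb_exists => /forallP eq_ord.
have {}eq_ord p q : p = q by have := eq_ord (p, q); rewrite negbK => /eqP.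
apply: Ad_span_ext Ad_span0 => X; suff -> : traceless (delta_mx k l) = 0.
  by rewrite scaler0.
rewrite (eq_ord l k); apply/matrixP => a b; rewrite (eq_ord a k) (eq_ord b k).
have d1 : d = 1%N.
  rewrite -[LHS]card_ord -(card1 k); apply: eq_card => a'; rewrite !inE.
  by rewrite (eq_ord a' k) eqxx.
rewrite /traceless /mxtrace !mxE (bigD1 k) //= big1 ?addr0 => [|c /negP[]].
  by rewrite !mxE !eqxx {1}d1 invr1 mul1r mulr1n subrr.
by rewrite (eq_ord c k).
Qed.

(** The difference [D] of [E] and the identity kills scalar matrices and has traceless values, so it
    is unchanged by [traceless] on both sides and expands in the maps of [Ad_span_rank1]. *)
Lemma unital_Ad_span (E : 'M[C]_d -> 'M[C]_d) :
  linear E -> trace_preserving E -> E 1%:M = 1%:M -> Ad_span E.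
Proof.
move=> lE tE uE; pose D X := E X - X.
have lD : linear D.
  by move=> a X Y; rewrite /D lE scalerBr opprD addrACA.
have DX X : D X = traceless (D (traceless X)).
  have -> : D (traceless X) = D X.
    rewrite /traceless -scalemx1 -[- _]scaleN1r scalerA linear_mapD //.
    by rewrite linear_mapZ // /D uE subrr scaler0 addr0.
  by rewrite /traceless linearB /= tE subrr mulr0 raddf0 subr0.
have s := Ad_span_sum (index_enum _)
  (fun (u : ('I_d * 'I_d) * ('I_d * 'I_d)) (_ : true) =>
  Ad_spanZ (D (delta_mx u.1.1 u.1.2) u.2.1 u.2.2)
    (Ad_span_rank1 u.1.1 u.1.2 u.2.1 u.2.2)).
apply: Ad_span_ext (Ad_spanD Ad_span_id s) => X /=.
apply/esym/eqP; rewrite addrC -subr_eq -/(D X) DX; apply/eqP.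
rewrite -(pair_big xpredT xpredT (fun u v : 'I_d * 'I_d =>
  D (delta_mx u.1 u.2) v.1 v.2 *:
   (traceless X u.1 u.2 *: traceless (delta_mx v.1 v.2)))) /=.
rewrite {1}[traceless X]matrix_sum_delta pair_big /= (linear_map_sum _ _ _ lD).
rewrite (linear_map_sum _ _ _ traceless_linear).
apply: eq_bigr => u _; rewrite (linear_mapZ _ lD) (linear_mapZ _ traceless_linear).
rewrite (traceless_sum (D _)) pair_big scaler_sumr.
by apply: eq_bigr => v _; rewrite !scalerA mulrC.
Qed.

End UnitalSpan.

(** * Equality of the two feasible sets *)

Section Programs.
Context {R : realType}.
Local Notation C := R[i].

Lemma mxtens_ext k m k' m' (A B : 'M[C]_(k * m, k' * m')) :
  (forall i a j b, A (mxtens_index (i, a)) (mxtens_index (j, b)) =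
    B (mxtens_index (i, a)) (mxtens_index (j, b))) -> A = B.
Proof.
move=> AB; apply/matrixP => u v.
by case: (mxtens_indexP u) => i a; case: (mxtens_indexP v) => j b.
Qed.

Lemma tensmxDr m n p q (A : 'M[C]_(m, n)) (B B' : 'M[C]_(p, q)) :
  A *t (B + B') = A *t B + A *t B'.
Proof. by apply: mxtens_ext => i a j b; rewrite [RHS]mxE !tensmxE mxE mulrDr. Qed.

Lemma tensmxZr m n p q c (A : 'M[C]_(m, n)) (B : 'M[C]_(p, q)) :
  A *t (c *: B) = c *: (A *t B).
Proof. by apply: mxtens_ext => i a j b; rewrite [RHS]mxE !tensmxE mxE mulrCA. Qed.

Lemma sum_delta_tensE k m n (F : 'I_k -> 'I_k -> 'M[C]_(m, n)) i a j b :
  (\sum_i \sum_j delta_mx i j *t F i j) (mxtens_index (i, a)) (mxtens_index (j, b))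
  = F i j a b.
Proof.
rewrite summxE.
rewrite (eq_bigr (fun p => \sum_q (delta_mx p q : 'M_k) i j * F p q a b));
  last first.
  by move=> p _; rewrite summxE; apply: eq_bigr => q _; rewrite tensmxE.
rewrite (bigD1 i) //= [X in _ + X]big1 ?addr0 => [|p pi]; last first.
  by rewrite big1 // => q _; rewrite mxE eq_sym (negbTE pi) mul0r.
rewrite (bigD1 j) //= big1 ?addr0 => [|q qj]; last first.
  by rewrite mxE (eq_sym j) (negbTE qj) andbF mul0r.
by rewrite mxE !eqxx mul1r.
Qed.

Lemma choiE d (E : 'M[C]_d -> 'M[C]_d) i a j b :
  choi E (mxtens_index (i, a)) (mxtens_index (j, b)) = E (delta_mx i j) a b.
Proof. by rewrite sum_delta_tensE. Qed.

Lemma ref_block_sum k m (X : 'M[C]_(k * m)) :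
  X = \sum_i \sum_j delta_mx i j *t ref_block X i j.
Proof. by apply: mxtens_ext => i a j b; rewrite sum_delta_tensE mxE. Qed.

Lemma id_tens_Ad k d (U : 'M[C]_d) (X : 'M[C]_(k * d)) :
  id_tens (Ad U) X = (1%:M *t U) *m X *m adjmx (1%:M *t U).
Proof.
rewrite [in RHS](ref_block_sum X) mulmx_sumr mulmx_suml; apply: eq_bigr => i _.
rewrite mulmx_sumr mulmx_suml; apply: eq_bigr => j _.
by rewrite adjmx_tens adjmx1 !tensmx_mul mul1mx mulmx1.
Qed.

Lemma psdmx_sandwich m n (A : 'M[C]_(m, n)) (X : 'M[C]_n) :
  psdmx X -> psdmx (A *m X *m adjmx A).
Proof.
move=> X0 v; have := X0 (adjmx A *m v).
by rewrite adjmxM adjmxK !mulmxA.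
Qed.

Lemma SU_unital_channel d (U : 'M[C]_d) : SU U -> unital_channels (Ad U).
Proof.
move=> [/unitarymxP UU _]; rewrite -[map_mx _ _]/(adjmx U) in UU.
split; last by rewrite /Ad mulmx1.
split; first exact: Ad_linear.
- by move=> k X X0; rewrite id_tens_Ad; apply: psdmx_sandwich.
- by move=> X; rewrite /Ad mxtrace_mulC mulmxA (mulmx1C UU) mul1mx.
Qed.

Lemma Ad_unitary_SU d (U : 'M[C]_d) :
  (0 < d)%N -> U \is unitarymx -> exists2 V, SU V & Ad V = Ad U.
Proof.
move=> d0 Uu; have UU : U *m adjmx U = 1%:M by apply/unitarymxP.
(* Multiplying [U] by the inverse phase w^* multiplies the determinant by its own conjugate, which
   gives 1. *)
pose w := d.-root (\det U).
have wd : w ^+ d = \det U by rewrite rootCK.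
have detU : \det U * (\det U)^* = 1.
  by have := congr1 determinant UU; rewrite det_mulmx det1 /adjmx det_map_mx det_tr.
have w1 : w * w^* = 1.
  rewrite -normCK norm_rootC.
  have -> : `|\det U| = 1 by apply/eqP; rewrite -sqrp_eq1 // normCK detU.
  by rewrite rootC1 // expr1n.
exists (w^* *: U).
  split; last by rewrite detZ -rmorphXn /= wd mulrC.
  apply/unitarymxP; rewrite -[map_mx _ _]/(adjmx (w^* *: U)) adjmxZ conjCK.
  by rewrite -scalemxAl -scalemxAr UU scalerA mulrC w1 scale1r.
apply: boolp.funext => X; rewrite /Ad adjmxZ conjCK -!scalemxAl -scalemxAr.
by rewrite scalerA mulrC w1 scale1r.
Qed.

(** One direction is inclusion of the target sets. For the other, [program_state] is linear in the
    channel, so the programming equation propagates along the induction on [Ad_span], through maps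
    that need not be channels. *)
Lemma programs_unital d (P : 'M[C]_(d * (d * d)) -> 'M[C]_d) :
  (0 < d)%N -> programs (@unital_channels R d) P <-> programs (@Ad_SU R d) P.
Proof.
move=> d0; split=> -[hP progP]; split=> // rho E rhos.
  by case=> U SU_U <-; apply: progP (SU_unital_channel SU_U).
case=> -[lE _ tE] uE; have [lP _ _] := hP.
elim: (unital_Ad_span lE tE uE) => {E lE tE uE}
    [U /(Ad_unitary_SU d0)[V SU_V <-]|E F _ IHE _ IHF|a E _ IHE|E F EF _ IHE].
- by apply: progP => //; exists V.
- rewrite -IHE -IHF -linear_mapD // -tensmxDr -scalerDr; congr (P (_ *t (_ *: _))).
  by apply: mxtens_ext => i a j b; rewrite [RHS]mxE !choiE mxE.
- rewrite -IHE -linear_mapZ // -tensmxZr scalerA mulrC -scalerA.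
  congr (P (_ *t (_ *: _))).
  by apply: mxtens_ext => i a' j b; rewrite [RHS]mxE !choiE mxE.
- rewrite -EF -IHE; congr (P (_ *t (_ *: _))).
  by apply: mxtens_ext => i a' j b; rewrite !choiE EF.
Qed.

End Programs.

(** * The minimal diamond norm is attained *)

Section DiamondNorm.
Context {R : realType}.
Local Notation C := R[i].

(** The output trace norm is replaced by its dual form, so that each condition, for fixed [X] and
    [B], is a closed half-space in the coefficients of a linear [P]. *)
Definition diamond_le m n (P : 'M[C]_m -> 'M[C]_n) (c : R) : Prop :=
  forall k (X : 'M[C]_(k * m)) (B : 'M[C]_(k * n)), trace_norm X <= 1 ->
  contraction B -> complex.Re (\tr (B *m id_tens P X)) <= c.

Lemma diamond_leP m n (P : 'M[C]_m -> 'M[C]_n) c :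
  (diamond_norm P <= c%:E)%E <-> diamond_le P c.
Proof.
split=> [Pc k X B X1 cB|Pc].
  have /trace_norm_leP -> // : trace_norm (id_tens P X) <= c.
  rewrite -lee_fin; apply: le_trans Pc; apply: ereal_sup_ubound.
  by exists k, X.
apply: ge_ereal_sup => _ [k [X [X1 ->]]]; rewrite lee_fin.
by apply/trace_norm_leP => B cB; apply: Pc.
Qed.

Lemma diamond_le_ge0 m n (P : 'M[C]_m -> 'M[C]_n) c : diamond_le P c -> 0 <= c.
Proof.
move=> /(_ 0 0 0); rewrite mul0mx mxtrace0; apply; last exact: contraction0.
by apply/trace_norm_leP => B _; rewrite mulmx0 mxtrace0 ler01.
Qed.

Lemma diamond_norm_ge0 m n (P : 'M[C]_m -> 'M[C]_n) : (0 <= diamond_norm P)%E.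
Proof.
pose X : 'M[C]_(0 * m) := 0; pose t := trace_norm (id_tens P X).
apply: (@le_trans _ _ t%:E).
  have /trace_norm_leP/(_ 0 (@contraction0 _ _ _)) := lexx t.
  by rewrite mul0mx mxtrace0 lee_fin.
apply: ereal_sup_ubound; exists 0%N, X; split=> //.
by apply/trace_norm_leP => B _; rewrite mulmx0 mxtrace0 ler01.
Qed.

Lemma id_tensE k m n (P : 'M[C]_m -> 'M[C]_n) (X : 'M[C]_(k * m)) i a j b :
  id_tens P X (mxtens_index (i, a)) (mxtens_index (j, b)) =
  P (ref_block X i j) a b.
Proof. by rewrite sum_delta_tensE. Qed.

Lemma contraction_tens_delta k m n (i : 'I_m) (j : 'I_n) :
  contraction ((1%:M : 'M[C]_k) *t delta_mx i j).
Proof.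
apply: contraction_proj; rewrite adjmx_tens adjmx1 adjmx_delta.
by rewrite !tensmx_mul !mul1mx !mul_delta_mx.
Qed.

Lemma contraction_delta m n (i : 'I_m) (j : 'I_n) :
  contraction (delta_mx i j : 'M[C]_(m, n)).
Proof. by apply: contraction_proj; rewrite adjmx_delta !mul_delta_mx. Qed.

(** This operator-sum form turns [id_tens P] into a combination of left and right multiplications by
    contractions. *)
Lemma linear_map_delta_sum m n (P : 'M[C]_m -> 'M[C]_n) Y : linear P ->
  P Y = \sum_(u : ('I_m * 'I_m) * ('I_n * 'I_n))
    P (delta_mx u.1.1 u.1.2) u.2.1 u.2.2 *:
      (delta_mx u.2.1 u.1.1 *m Y *m delta_mx u.1.2 u.2.2).
Proof.
move=> lP; rewrite {1}[Y]matrix_sum_delta pair_big /= (linear_map_sum _ _ _ lP).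
rewrite -(pair_big xpredT xpredT (fun u v => P (delta_mx u.1 u.2) v.1 v.2 *:
  (delta_mx v.1 u.1 *m Y *m delta_mx u.2 v.2))) /=.
apply: eq_bigr => -[a b] _; rewrite (linear_mapZ _ lP) /=.
rewrite {1}[P _]matrix_sum_delta pair_big scaler_sumr.
by apply: eq_bigr => -[e f] _; rewrite /= mulmx_delta !scalerA mulrC.
Qed.

(** The sum of the absolute values of the coefficients works for every reference dimension: each
    term of the operator sum is a coefficient times a trace bounded by [trace_norm_ge]. *)
Lemma diamond_le_exists m n (P : 'M[C]_m -> 'M[C]_n) :
  linear P -> exists c, diamond_le P c.
Proof.
move=> lP; pose c : C := \sum_(u : ('I_m * 'I_m) * ('I_n * 'I_n))
  `|P (delta_mx u.1.1 u.1.2) u.2.1 u.2.2|.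
have cR : ((complex.Re c)%:C)%C = c.
  by apply/RRe_real/ger0_real/sumr_ge0 => u _; exact: normr_ge0.
exists (complex.Re c) => k X B X1 cB.
have -> : id_tens P X = \sum_(u : ('I_m * 'I_m) * ('I_n * 'I_n))
    P (delta_mx u.1.1 u.1.2) u.2.1 u.2.2 *:
    ((1%:M *t delta_mx u.2.1 u.1.1) *m X *m (1%:M *t delta_mx u.1.2 u.2.2)).
  apply: mxtens_ext => i a j b; rewrite id_tensE (linear_map_delta_sum _ lP).
  rewrite !summxE; apply: eq_bigr => -[[a' b'] [e f]] _ /=.
  rewrite mxE [RHS]mxE; congr (_ * _).
  rewrite [in RHS](ref_block_sum X) mulmx_sumr mulmx_suml.
  transitivity ((\sum_i \sum_j delta_mx i j *t
    (delta_mx e a' *m ref_block X i j *m delta_mx b' f))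
    (mxtens_index (i, a)) (mxtens_index (j, b))); first by rewrite sum_delta_tensE.
  congr (fun_of_matrix _ _ _); apply: eq_bigr => p _.
  rewrite mulmx_sumr mulmx_suml; apply: eq_bigr => q _.
  by rewrite !tensmx_mul mul1mx mulmx1.
apply: Re_le_norm; rewrite cR mulmx_sumr raddf_sum.
apply: le_trans (ler_norm_sum _ _ _) _; apply: ler_sum => u _.
rewrite /= -scalemxAr mxtraceZ normrM ler_piMr //.
rewrite mulmxA mxtrace_mulC !mulmxA; apply: (@le_trans _ _ ((trace_norm X)%:C)%C).
  apply: trace_norm_ge; apply: contractionM; last exact: contraction_tens_delta.
  by apply: contractionM; first exact: contraction_tens_delta.
by rewrite lecR.
Qed.

Lemma dotmxEnorm n (u : 'rV[C]_n) : dotmx u u = \sum_i `|u 0 i| ^+ 2.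
Proof. by rewrite dotmx_adj mxE; apply: eq_bigr => i _; rewrite !mxE normCK. Qed.

Lemma contraction_entry m n (B : 'M[C]_(m, n)) i j : contraction B -> `|B i j| <= 1.
Proof.
move=> /(_ (delta_mx 0 i)); rewrite -rowE !dotmxEnorm.
rewrite [X in _ <= X](bigD1 i) //= [X in _ <= _ + X]big1 => [|k ki]; last first.
  by rewrite mxE (negbTE ki) andbF normr0 expr0n.
rewrite mxE !eqxx normr1 expr1n addr0 (bigD1 j) //= mxE => Bij.
rewrite -(@expr_le1 _ 2) //; apply: le_trans Bij.
by rewrite lerDl sumr_ge0 // => k _; rewrite exprn_ge0.
Qed.

(** A one-dimensional reference suffices: the input is a matrix unit, and the contraction is [z]
    times the matrix unit that reads off the entry. Varying the phase [z] controls both real and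
    imaginary parts. *)
Lemma diamond_le_entry m n (P : 'M[C]_m -> 'M[C]_n) c a b e f (z : C) :
  `|z| <= 1 -> diamond_le P c -> complex.Re (z * P (delta_mx a b) e f) <= c.
Proof.
move=> z1 Pc; pose X : 'M[C]_(1 * m) :=
  delta_mx (mxtens_index (0, a)) (mxtens_index (0, b)).
pose B : 'M[C]_(1 * n) :=
  z *: delta_mx (mxtens_index (0, f)) (mxtens_index (0, e)).
have tr_delta k (Y : 'M[C]_k) i j : \tr (delta_mx i j *m Y) = Y j i.
  rewrite /mxtrace (bigD1 i) //= big1 ?addr0 => [|l li]; last first.
    by rewrite mxE big1 // => l' _; rewrite mxE (negbTE li) mul0r.
  rewrite mxE (bigD1 j) //= big1 ?addr0 => [|l lj]; last first.
    by rewrite mxE (negbTE lj) andbF mul0r.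
  by rewrite mxE !eqxx mul1r.
have := Pc 1%N X B; rewrite /B -scalemxAl mxtraceZ tr_delta id_tensE.
have -> : ref_block X 0 0 = delta_mx a b.
  apply/matrixP => p q; rewrite !mxE !(can_eq (@mxtens_indexK _ _)).
  by rewrite !xpair_eqE !eqxx.
apply.
  apply/trace_norm_leP => B' cB'; rewrite mxtrace_mulC tr_delta.
  exact/Re_le_norm/contraction_entry.
by apply: contractionZ => //; exact: contraction_delta.
Qed.

End DiamondNorm.

(** * A map that programs every linear trace-preserving map *)

Section UniversalProgram.
Context {R : realType} {d : nat}.
Local Notation C := R[i].

(* [E rho = d tr_1 ((rho^T (x) 1) program_state E)] is bilinear in [rho] and the
   program, so it extends to a linear map on the whole tensor product. *)
Definition choi_apply (Y : 'M[C]_(d * (d * d))) : 'M[C]_d := \matrix_(k, l)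
  (d%:R * \sum_i \sum_j
    Y (mxtens_index (i, mxtens_index (i, k))) (mxtens_index (j, mxtens_index (j, l)))).

(** The multiple of the identity restores trace preservation on all inputs; it vanishes on the
    inputs of [universal_program_eval], where [choi_apply] already preserves the trace. *)
Definition universal_program (Y : 'M[C]_(d * (d * d))) : 'M[C]_d :=
  choi_apply Y + (d%:R^-1 * (\tr Y - \tr (choi_apply Y)))%:M.

Lemma mxtrace_tens m n (A : 'M[C]_m) (B : 'M[C]_n) : \tr (A *t B) = \tr A * \tr B.
Proof.
rewrite mulr_sum; apply: eq_bigr => u _.
by case: (mxtens_indexP u) => i j; rewrite tensmxE mxtens_indexK.
Qed.

Lemma mxtrace_adjmx n (A : 'M[C]_n) : \tr (adjmx A) = (\tr A)^*.
Proof. by rewrite /adjmx -map_trmx mxtrace_tr trace_map_mx. Qed.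

Lemma choi_apply_linear : linear choi_apply.
Proof.
move=> a X Y; apply/matrixP => k l; rewrite !mxE mulrCA -mulrDr; congr (_ * _).
rewrite mulr_sumr -big_split /=; apply: eq_bigr => i _; rewrite mulr_sumr -big_split /=.
by apply: eq_bigr => j _; rewrite !mxE.
Qed.

Lemma choi_apply_adjmx Y : adjmx (choi_apply Y) = choi_apply (adjmx Y).
Proof.
apply/matrixP => k l; rewrite !mxE rmorphM rmorph_nat exchange_big; congr (_ * _).
rewrite rmorph_sum; apply: eq_bigr => i _; rewrite rmorph_sum.
by apply: eq_bigr => j _; rewrite !mxE.
Qed.

Lemma universal_program_hptp : (0 < d)%N -> is_hptp universal_program.
Proof.
move=> d0; have dC : d%:R != 0 :> C by rewrite pnatr_eq0 -lt0n.
split.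
- move=> a X Y; rewrite /universal_program choi_apply_linear.
  rewrite !mxtraceD !mxtraceZ opprD addrACA -mulrBr mulrDr raddfD /= mulrCA.
  by rewrite -(scale_scalar_mx _ a) scalerDr addrACA.
- move=> Y Yh; rewrite /universal_program adjmxD choi_apply_adjmx Yh; congr (_ + _).
  rewrite /adjmx tr_scalar_mx map_scalar_mx /= rmorphM rmorphB fmorphV rmorph_nat.
  by rewrite /= -!mxtrace_adjmx choi_apply_adjmx Yh.
- move=> Y; rewrite /universal_program mxtraceD mxtrace_scalar.
  by rewrite -[(_ * _) *+ _]mulr_natr mulrAC mulVf // mul1r addrC subrK.
Qed.

Lemma universal_program_eval (rho : 'M[C]_d) E :
  (0 < d)%N -> linear E -> trace_preserving E ->
  universal_program (rho *t program_state E) = E rho.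
Proof.
move=> d0 lE tE; have dC : d%:R != 0 :> C by rewrite pnatr_eq0 -lt0n.
have chE : choi_apply (rho *t program_state E) = E rho.
  apply/matrixP => k l; rewrite mxE {2}[rho]matrix_sum_delta.
  rewrite (linear_map_sum _ _ _ lE) summxE mulr_sumr; apply: eq_bigr => i _.
  rewrite (linear_map_sum _ _ _ lE) summxE mulr_sumr; apply: eq_bigr => j _.
  rewrite tensmxE mxE choiE (linear_mapZ _ lE) mxE mulrCA; congr (_ * _).
  by rewrite mulrA mulfV // mul1r.
rewrite /universal_program chE tE mxtrace_tens.
suff -> : \tr (program_state E) = 1.
  by rewrite mulr1 subrr mulr0 raddf0 addr0.
have tr_delta i j : \tr (delta_mx i j : 'M[C]_d) = (i == j)%:R.
  rewrite /mxtrace (bigD1 i) //= big1 ?addr0 => [|k ki]; last first.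
    by rewrite mxE (negbTE ki).
  by rewrite mxE eqxx.
rewrite mxtraceZ raddf_sum /= (eq_bigr (fun=> 1)) => [|i _].
  by rewrite sumr_const card_ord mulVf.
rewrite raddf_sum (bigD1 i) //= big1 ?addr0 => [|j ji].
  by rewrite mxtrace_tens tE tr_delta eqxx mulr1.
by rewrite mxtrace_tens tr_delta eq_sym (negbTE ji) mul0r.
Qed.

End UniversalProgram.

Local Open Scope classical_set_scope.

(** * Closed conditions on complex-valued functions *)

Section ComplexContinuity.
Context {R : realType} {T : topologicalType}.
Local Notation C := R[i].
Implicit Types (f g : T -> C).

Definition continuousC f :=
  continuous (fun t => complex.Re (f t)) /\ continuous (fun t => complex.Im (f t)).

Lemma continuousC_cst a : continuousC (fun=> a).
Proof. by split; apply: cst_continuous. Qed.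

Lemma continuousCD f g :
  continuousC f -> continuousC g -> continuousC (fun t => f t + g t).
Proof.
move=> [rf If] [rg Ig]; split=> t.
  rewrite (_ : (fun t => _) = (fun t => complex.Re (f t) + complex.Re (g t))).
    by apply: cvgD; [apply: rf | apply: rg].
  by apply/funext => s; rewrite raddfD.
rewrite (_ : (fun t => _) = (fun t => complex.Im (f t) + complex.Im (g t))).
  by apply: cvgD; [apply: If | apply: Ig].
by apply/funext => s; rewrite raddfD.
Qed.

Lemma continuousC_conj f : continuousC f -> continuousC (fun t => (f t)^*).
Proof.
move=> [rf If]; split=> t.
  rewrite (_ : (fun t => _) = (fun t => complex.Re (f t))); first exact: rf.
  by apply/funext => s; case: (f s).
rewrite (_ : (fun t => _) = (fun t => - complex.Im (f t))).
  by apply: cvgN; apply: If.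
by apply/funext => s; case: (f s).
Qed.

Lemma continuousCMl a f : continuousC f -> continuousC (fun t => a * f t).
Proof.
move=> [rf If]; split=> t.
  rewrite (_ : (fun t => _) = (fun t => complex.Re a * complex.Re (f t) -
      complex.Im a * complex.Im (f t))).
    by apply: cvgB; apply: cvgM;
      [exact: cvg_cst | exact: rf | exact: cvg_cst | exact: If].
  by apply/funext => s; case: a (f s) => [? ?] [].
rewrite (_ : (fun t => _) = (fun t => complex.Re a * complex.Im (f t) +
    complex.Im a * complex.Re (f t))).
  by apply: cvgD; apply: cvgM;
    [exact: cvg_cst | exact: If | exact: cvg_cst | exact: rf].
by apply/funext => s; case: a (f s) => [? ?] [].
Qed.

Lemma continuousC_sum I (r : seq I) (P : pred I) (f : I -> T -> C) :
  (forall i, P i -> continuousC (f i)) ->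
  continuousC (fun t => \sum_(i <- r | P i) f i t).
Proof.
move=> cf; elim: r => [|i r IHr].
  rewrite (_ : (fun t => _) = (fun=> 0)); first exact: continuousC_cst.
  by apply/funext => t; rewrite big_nil.
case Pi: (P i); last first.
  rewrite (_ : (fun t => _) = (fun t => \sum_(i <- r | P i) f i t)) //.
  by apply/funext => t; rewrite big_cons Pi.
rewrite (_ : (fun t => _) = (fun t => f i t + \sum_(i <- r | P i) f i t)).
  exact: continuousCD (cf _ Pi) IHr.
by apply/funext => t; rewrite big_cons Pi.
Qed.

Lemma closure_Re_le (A : set T) f c t :
  continuousC f -> (forall s, A s -> complex.Re (f s) <= c) ->
  closure A t -> complex.Re (f t) <= c.
Proof.
move=> [rf _] Ac; have /closure_id cl : closed [set s | complex.Re (f s) <= c].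
  by apply: (preimage_closed (f := fun s => complex.Re (f s)) _ (@closed_le _ c)).
move=> At; suff : closure [set s | complex.Re (f s) <= c] t by rewrite -cl.
exact: closureS At.
Qed.

Lemma closure_eqC (A : set T) f g t :
  continuousC f -> continuousC g -> (forall s, A s -> f s = g s) ->
  closure A t -> f t = g t.
Proof.
move=> cf cg fg At.
have cfg a : continuousC (fun s => a * (f s + (-1) * g s)).
  by apply/continuousCMl/continuousCD => //; apply: continuousCMl.
have le0 a : complex.Re (a * (f t + (-1) * g t)) <= 0.
  apply: (closure_Re_le (cfg a) _ At) => s As.
  by rewrite (fg s As) mulN1r subrr mulr0.
(* With this multiplier the inequality says that the squared modulus of [f t - g t] is at most 0. *)
have := le0 (f t - g t)^*; rewrite mulN1r mulrC -normCK -add_Re2_Im2 /= -lecR.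
rewrite add_Re2_Im2 => w0; apply/eqP.
by rewrite -subr_eq0 -normr_eq0 -sqrf_eq0 eq_le w0 exprn_ge0.
Qed.

End ComplexContinuity.

(** * Compactness in the space of coefficients *)

Section Attained.
Context {R : realType} {m n : nat}.
Local Notation C := R[i].
Local Notation index := (('I_m * 'I_m) * ('I_n * 'I_n))%type.
Local Notation param := {ptws (index * bool)%type -> R}.
Implicit Types (P : 'M[C]_m -> 'M[C]_n) (p : param).

(** The coefficients on matrix units are stored as real coordinates, [false] for real and [true] for
    imaginary parts, with the product topology, so that boxes are compact by Tychonoff. *)
Definition map_of_param p (X : 'M[C]_m) : 'M[C]_n :=
  \sum_(u : index) ((p (u, false) +i* p (u, true))%C * X u.1.1 u.1.2) *:
    delta_mx u.2.1 u.2.2.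

Definition param_of_map P : param := fun u =>
  let z := P (delta_mx u.1.1.1 u.1.1.2) u.1.2.1 u.1.2.2 in
  if u.2 then complex.Im z else complex.Re z.

Lemma param_of_mapK P : linear P -> map_of_param (param_of_map P) = P.
Proof.
move=> lP; apply/funext => X; rewrite (linear_map_delta_sum X lP).
apply: eq_bigr => -[[a b] [e f]] _ /=; rewrite mulmx_delta scalerA /param_of_map /=.
by case: (P _ _ _).
Qed.

Lemma map_of_param_linear p : linear (map_of_param p).
Proof.
move=> a X Y; rewrite /map_of_param scaler_sumr -big_split; apply: eq_bigr => u _ /=.
by rewrite !mxE mulrDr scalerDl scalerA mulrCA.
Qed.

Lemma map_of_param_delta p a b e f :
  map_of_param p (delta_mx a b) e f =
  (p ((a, b, (e, f)), false) +i* p ((a, b, (e, f)), true))%C.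
Proof.
rewrite /map_of_param summxE (bigD1 (a, b, (e, f))) //= big1 ?addr0.
  by rewrite !mxE !eqxx !mulr1.
case=> -[a' b'] [e' f'] /= neq; rewrite !mxE.
have [/andP[/eqP aa /eqP bb]|] := boolP ((a' == a) && (b' == b)); last first.
  by rewrite mulr0 mul0r.
have [/andP[/eqP ee /eqP ff]|] := boolP ((e == e') && (f == f')).
  by rewrite aa bb ee ff eqxx in neq.
by rewrite !mulr0.
Qed.

Lemma continuousC_param X e f : continuousC (fun p => map_of_param p X e f).
Proof.
rewrite (_ : (fun p => _) = (fun p => \sum_(u : index)
    (X u.1.1 u.1.2 * delta_mx u.2.1 u.2.2 e f) * (p (u, false) +i* p (u, true))%C)).
  apply: continuousC_sum => u _; apply: continuousCMl.
  by split; [exact: (@proj_continuous _ (fun=> R) (u, false)) |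
             exact: (@proj_continuous _ (fun=> R) (u, true))].
apply/funext => p; rewrite summxE; apply: eq_bigr => u _.
by rewrite mxE -mulrA mulrC.
Qed.

Lemma continuousC_trace_param k (X : 'M[C]_(k * m)) (B : 'M[C]_(k * n)) :
  continuousC (fun p => \tr (B *m id_tens (map_of_param p) X)).
Proof.
apply: continuousC_sum => u _.
rewrite (_ : (fun p => _) =
    (fun p => \sum_v B u v * id_tens (map_of_param p) X v u)); last first.
  by apply/funext => p; rewrite mxE.
apply: continuousC_sum => v _; apply: continuousCMl.
case: (mxtens_indexP u) => j b; case: (mxtens_indexP v) => i a.
rewrite (_ : (fun p => _) = (fun p => map_of_param p (ref_block X i j) a b)).
  exact: continuousC_param.
by apply/funext => p; rewrite id_tensE.
Qed.

Lemma closure_diamond_le (A : set param) c p :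
  (forall q, A q -> diamond_le (map_of_param q) c) -> closure A p ->
  diamond_le (map_of_param p) c.
Proof.
move=> Ac Ap k X B X1 cB.
by apply: closure_Re_le (continuousC_trace_param X B) _ Ap => q /Ac; apply.
Qed.

Lemma closure_map_eq (A : set param) X Y p :
  (forall q, A q -> map_of_param q X = Y) -> closure A p ->
  map_of_param p X = Y.
Proof.
move=> AXY Ap; apply/matrixP => e f.
by apply: closure_eqC (continuousC_param X e f) (continuousC_cst _) _ Ap => q /AXY ->.
Qed.

Lemma closure_hptp (A : set param) p :
  (forall q, A q -> is_hptp (map_of_param q)) -> closure A p ->
  is_hptp (map_of_param p).
Proof.
move=> Ah Ap; split; first exact: map_of_param_linear.
  move=> X Xh; apply/matrixP => e f; rewrite !mxE.
  apply: closure_eqC (continuousC_conj (continuousC_param X f e))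
    (continuousC_param X e f) _ Ap => q /Ah[_ /(_ X Xh) qX _].
  by rewrite -[in RHS]qX !mxE.
move=> X; apply: (closure_eqC (f := fun q => \tr (map_of_param q X))
  (g := fun=> \tr X) _ _ _ Ap) => [||q /Ah[_ _ ->] //].
  by apply: continuousC_sum => e _; exact: continuousC_param.
exact: continuousC_cst.
Qed.

Lemma diamond_le_param_bound p c u : diamond_le (map_of_param p) c -> - c <= p u <= c.
Proof.
case: u => -[[a b] [e f]] s pc.
have bound z : `|z| = 1 -> complex.Re
    (z * (p ((a, b, (e, f)), false) +i* p ((a, b, (e, f)), true))%C) <= c.
  by move=> z1; rewrite -map_of_param_delta; apply: diamond_le_entry; rewrite ?z1.
have ni : `|'i%C| = 1 :> C by rewrite complexiE normCi.
(* The phases -i and i bound the imaginary part on both sides; below, 1 and -1 do so for the real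
   part. *)
case: s; rewrite lerNl.
  have := bound (- 'i%C); have := bound ('i%C); rewrite normrN ni /=.
  rewrite !mul0r ?oppr0 !mul0r !mulN1r !mul1r !sub0r opprK.
  by move=> /(_ erefl) -> /(_ erefl) ->.
have := bound (-1); have := bound 1; rewrite normrN normr1 mulN1r mul1r /=.
by move=> /(_ erefl) -> /(_ erefl) ->.
Qed.

End Attained.

(** [universal_program] makes the problem feasible with a finite bound; a minimizer is then a common
    point of the sublevel sets above the infimum. *)
Lemma overhead_exists (R : realType) (d : nat) (S : set ('M[R[i]]_d -> 'M[R[i]]_d)) :
  (0 < d)%N -> (forall E, S E -> linear E /\ trace_preserving E) ->
  exists v, is_overhead S v.
Proof.
move=> d0 Schan; pose P0 := @universal_program R d.
have progP0 : programs S P0.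
  split=> [|rho E _ /Schan[lE tE]]; first exact: universal_program_hptp.
  exact: universal_program_eval.
pose V := [set c : R | exists2 P, programs S P & diamond_le P c].
have infV : has_inf V.
  split; last by exists 0 => c [P _ /diamond_le_ge0].
  by have [[/diamond_le_exists[c Pc] _ _] _] := progP0; exists c; exists P0.
pose m := (d * (d * d))%N.
pose sub c := [set p : {ptws (('I_m * 'I_m) * ('I_d * 'I_d) * bool)%type -> R} |
  programs S (map_of_param p) /\ diamond_le (map_of_param p) c].
have sub_mono c c' : c <= c' -> sub c `<=` sub c'.
  by move=> cc p [progp pc]; split=> // k X B X1 cB; apply: le_trans cc; apply: pc.
(* Strictness matters: at the infimum itself nonemptiness is what has to be proved. *)
have sub_ne c : inf V < c -> sub c !=set0.
  move=> /(inf_lt infV.1)[c' [P [hP progP] Pc'] c'c].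
  have [lP _ _] := hP; exists (param_of_map P).
  by apply: (sub_mono _ _ (ltW c'c)); split; rewrite param_of_mapK.
have sub_closed c p : closure (sub c) p -> sub c p.
  move=> clp; split; last by apply: closure_diamond_le clp => q [].
  split=> [|rho E rhos SE]; first by apply: closure_hptp clp => q [[]].
  by apply: closure_map_eq clp => q [[_ progq] _]; exact: progq.
(* Any level above [v] would do for [b]: one sublevel set inside a compact box is enough. *)
pose v := inf V; pose b := v + 1.
have box_compact : compact
    [set p : {ptws (('I_m * 'I_m) * ('I_d * 'I_d) * bool)%type -> R} |
      forall u, `[- b, b]%classic (p u)].
  apply: (@tychonoff _ (fun=> R) (fun=> `[- b, b]%classic)) => u.
  exact: segment_compact.
pose F := filter_from [set c | v < c] sub.
have FF : ProperFilter F.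
  apply: filter_from_proper => [|c /sub_ne //].
  apply: filter_from_filter; first by exists b; rewrite /= ltrDl ltr01.
  move=> c c' vc vc'; exists (Num.min c c'); first by rewrite /= lt_min vc vc'.
  by move=> p pc; split; apply: sub_mono pc; rewrite ge_min lexx ?orbT.
(* The box belongs to [F] because it contains [sub b], so [F] has a cluster point; closedness puts
   that point in every [sub c] with [v < c]. *)
have [|p [_ clp]] := box_compact F FF.
  exists b; first by rewrite /= ltrDl ltr01.
  by move=> p [_ pb] u; rewrite /= in_itv; apply: diamond_le_param_bound pb.
have subp c : v < c -> sub c p.
  move=> vc; apply: sub_closed; move: clp; rewrite clusterE; apply.
  by exists c.
have [progp _] : sub b p by apply: subp; rewrite ltrDl ltr01.
have lower P : programs S P -> (v%:E <= diamond_norm P)%E.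
  move=> progP; have := diamond_norm_ge0 P; case E: (diamond_norm P) => [c||].
  - move=> _; rewrite lee_fin; apply: ge_inf; first by case: infV.
    by exists P => //; apply/diamond_leP; rewrite E.
  - by move=> _; rewrite leey.
  - by rewrite leeNy_eq.
exists v; split=> //; exists (map_of_param p) => //.
(* The limit map satisfies the bound [v + e] for every positive [e], hence the bound [v]. *)
apply/eqP; rewrite eq_le lower // andbT; apply/diamond_leP => k X B X1 cB.
apply/ler_addgt0Pr => e e0; have [_] : sub (v + e) p by apply: subp; rewrite ltrDl.
exact.
Qed.

(* Existence of the two minima is part of the claim that they are equal. *)
Theorem corollaryS17 (R : realType) (d : nat) (hd : (0 < d)%N) :
  exists v : R,
    is_overhead (@unital_channels R d) v /\ is_overhead (@Ad_SU R d) v.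
Proof.
have [|v [[P progP Pv] lower]] := @overhead_exists R d (@unital_channels R d) hd.
  by move=> E [[]].
exists v; split; first by split=> //; exists P.
split; first by exists P => //; apply/programs_unital.
by move=> Q /(programs_unital _ hd)/lower.
Qed.
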